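(* Consider a finite ergodic Markov chain $P$ with uniform stationary distribution on a state space $\Omega$ of size $N$. Let $T\ge 0$ be an integer such that $\frac{m}{N}\le P^T(u,v)\le\frac{M}{N}$ for some reals $0<m\le 1\le M$ and every pair of states $u,v\in\Omega$. Let $A_T=\max_u\sum_v G_T^2(u,v)$ and $A_T^*=\max_u\sum_v G_T^2(v,u)$, where $G_T(u,v)=\sum_{i=0}^T P^i(u,v)$. Then after $$4c\left(\frac{M}{m}\right)^2\left(\sqrt{\frac{2N}{M}\max\{A_T,A_T^*\}}+T\right)$$ steps a collision occurs with probability at least $1-e^{-c}$, for any $c\ge 0$.
   Context: $P^i(u,v)$ is the $i$-step transition probability from $u$ to $v$, and $G_T^2(u,v)$ means $(G_T(u,v))^2$; $G_T(u,v)$ is the expected number of times a walk beginning at $u$ hits $v$ in $T$ steps. For an instance $X_0,X_1,X_2,\dots$ of the chain, a collision is a self-intersection $X_i=X_j$ for some $i\ne j$. Maxima and sums over $u$, $v$ are over $\Omega$.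
   Formalization: The number of steps must also be at least 2(√((2N/M)max{A_T,A_T*})+T), automatic for c ≥ m²/(2M²); for small c the claim fails, e.g. loopless walk on 3 states, T=2, m=3/4, M=3/2, c=1/100: under one step is required, yet X_0≠X_1. *)

(* Defs.v *)
From HB Require Import structures.
From mathcomp Require Import all_boot all_order all_algebra.
From mathcomp Require Import all_classical all_reals all_analysis.

Set Implicit Arguments.
Unset Strict Implicit.
Unset Printing Implicit Defensive.

Import Order.TTheory GRing.Theory Num.Theory.

Local Open Scope classical_set_scope.
Local Open Scope ring_scope.

Definition stochastic (R : realType) (Omega : finType)
    (P : Omega -> Omega -> R) : Prop :=
  (forall u v, 0 <= P u v) /\ (forall u, \sum_v P u v = 1).

Fixpoint nstep (R : realType) (Omega : finType) (P : Omega -> Omega -> R)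
    (i : nat) (u v : Omega) : R :=
  if i is j.+1 then \sum_w P u w * nstep P j w v else (u == v)%:R.

Definition irreducible (R : realType) (Omega : finType)
    (P : Omega -> Omega -> R) : Prop :=
  forall u v, exists i : nat, 0 < nstep P i u v.

(* The gcd of the positive return times to every state is 1. *)
Definition aperiodic (R : realType) (Omega : finType)
    (P : Omega -> Omega -> R) : Prop :=
  forall (u : Omega) (d : nat),
    (forall i : nat, (0 < i)%N -> 0 < nstep P i u u -> (d %| i)%N) -> d = 1%N.

Definition ergodic (R : realType) (Omega : finType)
    (P : Omega -> Omega -> R) : Prop :=
  irreducible P /\ aperiodic P.

Definition stationary (R : realType) (Omega : finType)
    (P : Omega -> Omega -> R) (mu : Omega -> R) : Prop :=
  forall v, \sum_u mu u * P u v = mu v.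

Definition uniform_dist (R : realType) (Omega : finType) : Omega -> R :=
  fun=> (#|Omega|%:R)^-1.

Definition green (R : realType) (Omega : finType) (P : Omega -> Omega -> R)
    (T : nat) (u v : Omega) : R :=
  \sum_(0 <= i < T.+1) nstep P i u v.

(* All the sums are nonnegative, so 0 is a neutral default for the maximum. *)
Definition A_out (R : realType) (Omega : finType) (P : Omega -> Omega -> R)
    (T : nat) : R :=
  \big[Num.max/0]_(u : Omega) \sum_(v : Omega) green P T u v ^+ 2.

Definition A_in (R : realType) (Omega : finType) (P : Omega -> Omega -> R)
    (T : nat) : R :=
  \big[Num.max/0]_(u : Omega) \sum_(v : Omega) green P T v u ^+ 2.

(* The law of X 0 is arbitrary.  The second clause is the Markov property
   Pr(X_{k+1} = x_{k+1} | X_0 = x_0, ..., X_k = x_k) = P(x_k, x_{k+1}),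
   multiplied out so that conditioning events of probability 0 are harmless. *)
Definition markov_chain (R : realType) (d : measure_display)
    (W : measurableType d) (Pr : probability W R) (Omega : finType)
    (P : Omega -> Omega -> R) (X : nat -> W -> Omega) : Prop :=
  (forall (i : nat) (v : Omega), measurable [set w | X i w = v]) /\
  (forall (k : nat) (x : nat -> Omega),
     Pr [set w | forall i : nat, (i <= k.+1)%N -> X i w = x i] =
     (Pr [set w | forall i : nat, (i <= k)%N -> X i w = x i]
        * (P (x k) (x k.+1))%:E)%E).

Definition collision_by (W : Type) (Omega : finType) (X : nat -> W -> Omega)
    (n : nat) : set W :=
  [set w | exists i j : nat,
     [/\ (i <= n)%N, (j <= n)%N, i <> j & X i w = X j w]].

(* Main.v *)
Require Import Defs.
From HB Require Import structures.
From mathcomp Require Import all_boot all_order all_algebra.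
From mathcomp Require Import all_classical all_reals all_analysis.
From mathcomp Require Import zify ring lra.

Set Implicit Arguments.
Unset Strict Implicit.
Unset Printing Implicit Defensive.

Import Order.TTheory GRing.Theory Num.Theory.

Local Open Scope classical_set_scope.
Local Open Scope ring_scope.

(** Write [A] for the larger of the two maxima [A_T] and [A_T^*], and put
    [sigma = sqrt (2NA/M)], [L = 2(sigma + T)] and [k = M/m].  The theorem
    follows from a bound uniform in the starting state: for [n >= L] a walk of
    [n] steps has no collision with probability at most [exp (- n/(2k^2L))]
    ([avoid_le]).

    A walk of [a + b] steps without collision has none in its first [a] steps
    and none in its last [b], so by the Markov property such bounds multiply
    ([pexp_uniqD]).  It is therefore enough to treat [L <= n <= 5L/2]
    ([avoid_short]): a longer walk is cut into pieces of these lengths, and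
    the exponents add up exactly.  Treating only [n = L] would not suffice,
    because rounding [n/L] down to a number of blocks loses up to half of the
    exponent.

    The bound for one piece is a second moment argument.  With [n = b + 2T],
    call a pair [p = (i, j)] with [i <= j <= b] admissible, let [E_p] be the
    event [X_i = X_(j+2T)], and let [S] be the sum over the admissible pairs of
    the indicators of [E_p] divided by [Pr(E_p)].  Without collision [S = 0];
    its mean is the number [Q] of admissible pairs, and its second moment is
    the sum of the ratios [Pr(E_p & E_q) / (Pr(E_p) Pr(E_q))].  The gap [2T]
    makes the walk mix between the start and the end of every pair, whence,
    for [p = (i, j)] and [q = (i', j')]:
    - if [|j - j'| >= T], the event that ends later has conditional
      probability at most [M/N] given the other, so the ratio is at most [k]
      ([corr_late]);
    - if [|j - j'| < T] but [|i - i'| >= T], then [Pr(E_p & E_q) <= (M/N)^2]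
      and the ratio is at most [k^2] ([corr_early]); the reflection
      [(i, j) -> (b - j, b - i)] exchanges the conditions on the two
      coordinates, so this concerns at most half of the pairs [(p, q)]
      ([sum_far_reflect]);
    - the remaining pairs are close in both coordinates, and the sum of
      [Pr(E_p & E_q)] over them is at most [4Q(M/N)A]: the two short excursions
      of such a pair add up to entries of [G_T] ([sum_nearby]).
    With [x = n/L], a collision thus has probability at least
    [1 / ((k + k^2)/2 + k^2/x^2)] ([no_collision_le]), and this is at least
    [1 - exp (- x/(2k^2))] for [1 <= x <= 5/2] ([block_bound]).  The unweighted
    count of collisions would only give [1 / (k^2 + k^2/x^2)], which is too
    small for [x > 1] when [k] is large.

    The computation takes place on the finite space of paths, where [pexp] is
    the expectation; [law_trace] transfers it to the given chain. *)

(** * Expectations over paths of the chain *)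

Section PathExpectation.
Variables (R : realType) (Omega : finType) (P : Omega -> Omega -> R).
Implicit Types (F : seq Omega -> R) (u v : Omega) (s : seq Omega).

(** Expectation of [F (X_0, ..., X_n)] for the chain started at [u]. The
    recursion is on the first step, so that the Markov property and the formulas
    below are plain inductions. *)
Fixpoint pexp (n : nat) (u : Omega) (F : seq Omega -> R) : R :=
  if n is n'.+1 then \sum_v P u v * pexp n' v (fun s => F (u :: s))
  else F [:: u].

Hypothesis hP : stochastic P.

Lemma pexp_le n u F F' :
  (forall s, size s = n -> F (u :: s) <= F' (u :: s)) ->
  pexp n u F <= pexp n u F'.
Proof.
elim: n u F F' => [|n IHn] u F F' leF /=; first exact: leF.
apply: ler_sum => v _; apply: ler_wpM2l; first exact: hP.1.
by apply: IHn => s ss; apply: leF; rewrite /= ss.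
Qed.

Lemma eq_pexp n u F F' :
  (forall s, size s = n -> F (u :: s) = F' (u :: s)) ->
  pexp n u F = pexp n u F'.
Proof.
by move=> eqF; apply/eqP; rewrite eq_le !pexp_le// => s /eqF ->.
Qed.

Lemma pexp_const n u (a : R) : pexp n u (fun=> a) = a.
Proof.
elim: n u => //= n IHn u; under eq_bigr do rewrite IHn.
by rewrite -mulr_suml hP.2 mul1r.
Qed.

Lemma pexp_sum (I : Type) (r : seq I) (A : pred I)
    (F : I -> seq Omega -> R) n u :
  pexp n u (fun s => \sum_(i <- r | A i) F i s) =
  \sum_(i <- r | A i) pexp n u (F i).
Proof.
elim: n u F => //= n IHn u F; rewrite exchange_big; apply: eq_bigr => v _.
by rewrite IHn mulr_sumr.
Qed.

Lemma pexpZ n u (a : R) F : pexp n u (fun s => a * F s) = a * pexp n u F.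
Proof.
elim: n u F => //= n IHn u F; rewrite mulr_sumr; apply: eq_bigr => v _.
by rewrite IHn mulrCA.
Qed.

Lemma pexpB n u F F' :
  pexp n u (fun s => F s - F' s) = pexp n u F - pexp n u F'.
Proof.
elim: n u F F' => //= n IHn u F F'; rewrite -sumrB; apply: eq_bigr => v _.
by rewrite IHn mulrBr.
Qed.

(* The default value of [nth], which is only taken at valid positions. *)
Variable x0 : Omega.

(** The Markov property at time [a]. The state at time [a] belongs to both
    halves, as the last entry of [take a.+1] and the first of [drop a]. *)
Lemma pexp_markov a b u F (G : seq Omega -> seq Omega -> R) :
  (forall s, F (u :: s) = G (take a.+1 (u :: s)) (drop a (u :: s))) ->
  pexp (a + b) u F = pexp a u (fun s => pexp b (nth x0 s a) (G s)).
Proof.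
move=> FG; transitivity
  (pexp (a + b) u (fun s => G (take a.+1 s) (drop a s))).
  by apply: eq_pexp => s _; exact: FG.
move: {F FG}G.
elim: a u => [|a IHa] u G.
  by apply: eq_pexp => s _ /=; rewrite take0.
rewrite addSn /=; apply: eq_bigr => v _; congr (_ * _).
exact: (IHa v (fun s => G (u :: s))).
Qed.

(** Summing over the state at time [t] turns a functional of that state and of
    the later ones into a matrix product; iterating gives the joint law at
    several times. *)
Lemma pexp_at t n u F (h : Omega -> seq Omega -> R) :
  (forall s, F (u :: s) = h (nth x0 (u :: s) t) (drop t (u :: s))) ->
  pexp (t + n) u F = \sum_v nstep P t u v * pexp n v (h v).
Proof.
move=> Fh; transitivity
  (pexp (t + n) u (fun s => h (nth x0 s t) (drop t s))).
  by apply: eq_pexp => s _; exact: Fh.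
move: {F Fh}h.
elim: t u => [|t IHt] u h.
  rewrite (bigD1 u)//= eqxx mul1r big1 ?addr0 => [|v vu].
    by apply: eq_pexp => s _.
  by rewrite eq_sym (negbTE vu) mul0r.
rewrite addSn /=; under eq_bigr do rewrite IHt mulr_sumr.
rewrite exchange_big; apply: eq_bigr => v _.
by rewrite mulr_suml; apply: eq_bigr => w _; rewrite mulrA.
Qed.

Lemma pexp_at1 t n u (f : Omega -> R) : (t <= n)%N ->
  pexp n u (fun s => f (nth x0 s t)) = \sum_v nstep P t u v * f v.
Proof.
move=> tn; rewrite -[n](subnKC tn) (@pexp_at _ _ _ _ (fun v _ => f v))//.
by apply: eq_bigr => v _; rewrite pexp_const.
Qed.

Lemma pexp_take t n u F : (t <= n)%N ->
  pexp n u (fun s => F (take t.+1 s)) = pexp t u F.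
Proof.
move=> tn; rewrite -[n](subnKC tn) (@pexp_markov _ _ _ _ (fun s _ => F s))//.
by apply: eq_pexp => s _; rewrite pexp_const.
Qed.

Lemma nstep_ge0 i u v : 0 <= nstep P i u v.
Proof.
elim: i u => [|i IHi] u /=; first by rewrite ler0n.
by apply: sumr_ge0 => w _; rewrite mulr_ge0 ?hP.1.
Qed.

Lemma nstep_sum1 i u : \sum_v nstep P i u v = 1.
Proof.
have := pexp_at1 u (fun=> 1) (leqnn i); rewrite pexp_const => ->.
by apply: eq_bigr => v _; rewrite mulr1.
Qed.

(** Bounds on the entries of [P^T] persist at later times, the rows of
    [P^(i+1)] being averages of rows of [P^i]. *)
Lemma nstep_le_later (B : R) T i : (T <= i)%N ->
  (forall u v, nstep P T u v <= B) -> forall u v, nstep P i u v <= B.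
Proof.
move=> Ti hB; rewrite -(subnK Ti); elim: (i - T)%N => //= j IHj u v.
rewrite -[leRHS]mul1r -(hP.2 u) mulr_suml; apply: ler_sum => w _.
by apply: ler_wpM2l; rewrite ?hP.1.
Qed.

Lemma nstep_ge_later (B : R) T i : (T <= i)%N ->
  (forall u v, B <= nstep P T u v) -> forall u v, B <= nstep P i u v.
Proof.
move=> Ti hB; rewrite -(subnK Ti); elim: (i - T)%N => //= j IHj u v.
rewrite -[leLHS]mul1r -(hP.2 u) mulr_suml; apply: ler_sum => w _.
by apply: ler_wpM2l; rewrite ?hP.1.
Qed.

Lemma col_sum1 : stationary P (@uniform_dist R Omega) ->
  forall v, \sum_u P u v = 1.
Proof.
move=> hst v; have := hst v; rewrite /uniform_dist -mulr_sumr => hv.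
have N0 : (#|Omega|%:R : R) != 0.
  by rewrite pnatr_eq0 -lt0n; apply/card_gt0P; exists v.
by apply: (mulfI (invr_neq0 N0)); rewrite hv mulr1.
Qed.

Lemma nstep_col_sum1 : stationary P (@uniform_dist R Omega) ->
  forall i v, \sum_u nstep P i u v = 1.
Proof.
move=> hst; elim=> [|i IHi] v /=.
  by rewrite (bigD1 v)//= eqxx big1 ?addr0 // => u /negbTE ->.
rewrite exchange_big -[RHS](IHi v) /=; apply: eq_bigr => w _.
by rewrite -mulr_suml col_sum1 // mul1r.
Qed.

(** Avoiding collisions is submultiplicative: it forces both halves of the walk
    to avoid them. *)
Lemma pexp_uniqD a b u (q : R) :
  (forall v, pexp b v (fun s => (uniq s)%:R) <= q) ->
  pexp (a + b) u (fun s => (uniq s)%:R) <=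
  pexp a u (fun s => (uniq s)%:R) * q.
Proof.
move=> hq.
apply: (@le_trans _ _ (pexp (a + b) u
   (fun s => (uniq (take a.+1 s))%:R * (uniq (drop a s))%:R))).
  apply: pexp_le => s _; rewrite -natrM ler_nat mulnb.
  by case: (boolP (uniq (u :: s))) => // us; rewrite take_uniq ?drop_uniq.
rewrite (@pexp_markov _ _ _ _ (fun s s' => (uniq s)%:R * (uniq s')%:R))//.
rewrite mulrC -pexpZ; apply: pexp_le => s _.
by rewrite pexpZ mulrC ler_wpM2r ?ler0n.
Qed.

(** The second moment method, for an [S] that vanishes on the paths without
    repetition. Instead of the Cauchy-Schwarz inequality it integrates the
    pointwise bound [2tS - S^2 <= t^2] on the paths with a repetition, at the
    optimal [t = sigma/mu]. *)
Lemma second_moment n u (S : seq Omega -> R) (mu sigma : R) :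
  0 < mu -> 0 < sigma ->
  (forall s, size s = n.+1 -> uniq s -> S s = 0) ->
  pexp n u S = mu -> pexp n u (fun s => S s ^+ 2) <= sigma ->
  pexp n u (fun s => (uniq s)%:R) <= 1 - mu ^+ 2 / sigma.
Proof.
move=> mu0 sg0 S0 ES ES2; set t := sigma / mu.
have t0 : 0 < t by rewrite divr_gt0.
have : pexp n u (fun s => 2 * t * S s - S s ^+ 2) <=
       pexp n u (fun s => t ^+ 2 * (1 - (uniq s)%:R)).
  apply: pexp_le => s ss; case: (boolP (uniq (u :: s))) => [us|_].
    by rewrite S0 /= ?ss// subrr mulr0 expr0n /= subr0 mulr0.
  rewrite subr0 mulr1 -subr_ge0.
  by rewrite (_ : _ - _ = (t - S (u :: s)) ^+ 2) ?sqr_ge0//; ring.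
rewrite pexpB !pexpZ pexpB pexp_const ES => h.
set q := pexp n u (fun s => (uniq s)%:R) in h *.
have {}h : 2 * t * mu - sigma <= t ^+ 2 * (1 - q) by apply: le_trans h; lra.
have e : 2 * t * mu - sigma = t ^+ 2 * (mu ^+ 2 / sigma).
  by rewrite /t; field; rewrite !lt0r_neq0.
rewrite e ler_pM2l ?exprn_gt0 // in h; lra.
Qed.

End PathExpectation.

(** * Joint laws of meetings *)

Section Meetings.
Variables (R : realType) (Omega : finType) (P : Omega -> Omega -> R).
Hypotheses (hP : stochastic P) (hst : stationary P (@uniform_dist R Omega)).
Variables (T : nat) (lo hi : R).
Hypothesis hlo : forall u v, lo <= nstep P T u v.
Hypothesis hhi : forall u v, nstep P T u v <= hi.
Variable x0 : Omega.
Implicit Types (u v : Omega) (s : seq Omega) (n i j k l : nat).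

Definition meet s i j : R := (nth x0 s i == nth x0 s j)%:R.

Lemma meet_ge0 s i j : 0 <= meet s i j. Proof. exact: ler0n. Qed.

Lemma hi_ge0 : 0 <= hi.
Proof. exact: le_trans (nstep_ge0 hP T x0 x0) (hhi x0 x0). Qed.

Lemma nstep_hi i u v : (T <= i)%N -> nstep P i u v <= hi.
Proof. by move=> Ti; exact: (nstep_le_later hP Ti hhi). Qed.

Lemma nstep_lo i u v : (T <= i)%N -> lo <= nstep P i u v.
Proof. by move=> Ti; exact: (nstep_ge_later hP Ti hlo). Qed.

Lemma sum_eqr (f : Omega -> R) v : \sum_w f w * (v == w)%:R = f v.
Proof.
rewrite (bigD1 v)//= eqxx mulr1 big1 ?addr0// => w /negbTE.
by rewrite eq_sym => ->; rewrite mulr0.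
Qed.

Lemma pexp_meet n u i j : (i <= j <= n)%N ->
  pexp P n u (fun s => meet s i j) =
  \sum_v nstep P i u v * nstep P (j - i) v v.
Proof.
move=> /andP[ij jn].
have -> : n = (i + ((j - i) + (n - j)))%N by lia.
rewrite (@pexp_at _ _ _ hP x0 _ _ _ _
  (fun v s => (v == nth x0 s (j - i))%:R)); last first.
  by move=> s; rewrite /meet nth_drop subnKC.
apply: eq_bigr => v _; congr (_ * _).
by rewrite (pexp_at1 hP x0 _ (fun w => (v == w)%:R)) ?leq_addr// sum_eqr.
Qed.

Lemma pexp_meet_lo n u i j : (i + T <= j <= n)%N ->
  lo <= pexp P n u (fun s => meet s i j).
Proof.
move=> ijn; rewrite pexp_meet; last by lia.
rewrite -[leLHS]mul1r -(nstep_sum1 hP x0 i u) mulr_suml.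
by apply: ler_sum => v _; rewrite ler_wpM2l ?nstep_ge0// nstep_lo//; lia.
Qed.

(** Given the walk up to the time [max (j, k)], the state at time [l] is any
    given state with probability at most [hi], whatever the order of [i], [j]
    and [k]. *)
Lemma pexp_meet2_late n u i j k l : (i <= j)%N -> (maxn j k + T <= l <= n)%N ->
  pexp P n u (fun s => meet s i j * meet s k l) <=
  pexp P n u (fun s => meet s i j) * hi.
Proof.
set a := maxn j k => ij aln.
have an : (a <= n)%N by lia.
have meet_take s : meet s i j = meet (take a.+1 s) i j.
  by rewrite /meet !nth_take//; rewrite /a; lia.
have -> : pexp P n u (fun s => meet s i j) = pexp P a u (fun s => meet s i j).
  rewrite -(pexp_take hP x0 u _ an).
  by apply: (eq_pexp hP) => s _; exact: meet_take.
rewrite -[n](subnKC an) (@pexp_markov _ _ _ hP x0 _ _ _ _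
  (fun s s' => meet s i j * (nth x0 s k == nth x0 s' (l - a))%:R)); last first.
  move=> s; rewrite {1}meet_take; congr (_ * _).
  rewrite /meet nth_drop nth_take; last by rewrite /a; lia.
  by rewrite subnKC//; lia.
rewrite mulrC -pexpZ; apply: (pexp_le hP) => s _; rewrite (pexpZ P) mulrC.
apply: ler_wpM2r; first exact: meet_ge0.
set x := nth x0 (u :: s) k.
rewrite (pexp_at1 hP x0 _ (fun w => (x == w)%:R)); last by lia.
by rewrite sum_eqr; apply: nstep_hi; lia.
Qed.

Lemma pexp_4times t1 t2 t3 t4 r u (g : Omega -> Omega -> Omega -> Omega -> R) :
  pexp P (t1 + (t2 + (t3 + (t4 + r)))) u (fun s =>
    g (nth x0 s t1) (nth x0 s (t1 + t2)) (nth x0 s (t1 + (t2 + t3)))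
      (nth x0 s (t1 + (t2 + (t3 + t4))))) =
  \sum_a nstep P t1 u a * \sum_b nstep P t2 a b *
    \sum_c nstep P t3 b c * \sum_d nstep P t4 c d * g a b c d.
Proof.
rewrite (@pexp_at _ _ _ hP x0 _ _ _ _ (fun a s => g a (nth x0 s t2)
  (nth x0 s (t2 + t3)) (nth x0 s (t2 + (t3 + t4))))); last first.
  by move=> s; rewrite !nth_drop.
apply: eq_bigr => a _; congr (_ * _).
rewrite (@pexp_at _ _ _ hP x0 _ _ _ _ (fun b s => g a b (nth x0 s t3)
  (nth x0 s (t3 + t4)))); last by move=> s; rewrite !nth_drop.
apply: eq_bigr => b _; congr (_ * _).
rewrite (@pexp_at _ _ _ hP x0 _ _ _ _ (fun c s => g a b c (nth x0 s t4)));
  last by move=> s; rewrite !nth_drop.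
apply: eq_bigr => c _; congr (_ * _).
by rewrite (pexp_at1 hP x0 _ (g a b c)) ?leq_addr.
Qed.

(** For the time order [i, k, j, l] the walk visits [a, b, a, b]; the long
    middle stretch from [b] to [a] costs at most [hi]. *)
Lemma meet2_interlaced n u i j k l :
  (i <= k)%N -> (k + T <= j)%N -> (j <= l <= n)%N ->
  pexp P n u (fun s => meet s i j * meet s k l) <=
  hi * \sum_a nstep P i u a *
       \sum_b nstep P (k - i) a b * nstep P (l - j) a b.
Proof.
move=> ik kj jln.
have := pexp_4times i (k - i) (j - k) (l - j) (n - l) u
  (fun a b c d => (a == c)%:R * (b == d)%:R).
have -> : (i + (k - i + (j - k + (l - j + (n - l)))))%N = n by lia.
have -> : (i + (k - i + (j - k + (l - j))))%N = l by lia.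
have -> : (i + (k - i + (j - k)))%N = j by lia.
have -> : (i + (k - i))%N = k by lia.
move=> ->; rewrite mulr_sumr; apply: ler_sum => a _.
rewrite mulrCA ler_wpM2l ?nstep_ge0// mulr_sumr; apply: ler_sum => b _.
rewrite mulrCA ler_wpM2l ?nstep_ge0//.
under eq_bigr => c _ do under eq_bigr do rewrite mulrCA mulrC.
under eq_bigr => c _ do rewrite -mulr_suml sum_eqr mulrA.
by rewrite sum_eqr ler_wpM2r ?nstep_ge0// nstep_hi//; lia.
Qed.

(** For the time order [i, k, l, j] the walk visits [a, b, b, a]; the long
    middle stretch from [b] to [b] costs at most [hi]. *)
Lemma meet2_nested n u i j k l :
  (i <= k)%N -> (k + T <= l)%N -> (l <= j <= n)%N ->
  pexp P n u (fun s => meet s i j * meet s k l) <=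
  hi * \sum_a nstep P i u a *
       \sum_b nstep P (k - i) a b * nstep P (j - l) b a.
Proof.
move=> ik kl ljn.
have := pexp_4times i (k - i) (l - k) (j - l) (n - j) u
  (fun a b c d => (a == d)%:R * (b == c)%:R).
have -> : (i + (k - i + (l - k + (j - l + (n - j)))))%N = n by lia.
have -> : (i + (k - i + (l - k + (j - l))))%N = j by lia.
have -> : (i + (k - i + (l - k)))%N = l by lia.
have -> : (i + (k - i))%N = k by lia.
move=> ->; rewrite mulr_sumr; apply: ler_sum => a _.
rewrite mulrCA ler_wpM2l ?nstep_ge0// mulr_sumr; apply: ler_sum => b _.
rewrite mulrCA ler_wpM2l ?nstep_ge0//.
under eq_bigr => c _ do under eq_bigr do rewrite mulrA.
under eq_bigr => c _ do rewrite -mulr_suml sum_eqr mulrA.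
by rewrite sum_eqr ler_wpM2r ?nstep_ge0// nstep_hi//; lia.
Qed.

(** The stretches from [i] to [k] and from [k] to the next time are both long,
    and the last stretch sums to one over the intermediate state: over rows for
    interlaced pairs, over columns, hence by uniform stationarity, for nested
    ones. *)
Lemma meet2_early n u i j k l :
  (i + T <= k)%N -> (k + T <= minn j l)%N -> (maxn j l <= n)%N ->
  pexp P n u (fun s => meet s i j * meet s k l) <= hi ^+ 2.
Proof.
move=> ik kjl jln; rewrite expr2 -[leRHS]mulr1.
have main (f : Omega -> Omega -> R) :
    (forall a b, 0 <= f a b) -> (forall a, \sum_b f a b = 1) ->
  hi * \sum_a nstep P i u a * \sum_b nstep P (k - i) a b * f a b <= hi * hi * 1.
  move=> f0 f1; rewrite -mulrA ler_wpM2l ?hi_ge0// -(nstep_sum1 hP x0 i u).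
  rewrite mulrC mulr_suml; apply: ler_sum => a _.
  rewrite ler_wpM2l ?nstep_ge0// -[leRHS]mulr1 -(f1 a) mulr_sumr.
  by apply: ler_sum => b _; rewrite ler_wpM2r// nstep_hi//; lia.
have [jl|lj] := leqP j l.
  apply: (le_trans (meet2_interlaced _ _ _ _)); try lia.
  apply: (main (fun a b => nstep P (l - j) a b)) => *; first exact: nstep_ge0.
  exact: nstep_sum1.
apply: (le_trans (meet2_nested _ _ _ _)); try lia.
apply: (main (fun a b => nstep P (j - l) b a)) => *; first exact: nstep_ge0.
exact: nstep_col_sum1.
Qed.

(** * The second moment of the weighted number of meetings *)

Hypotheses (T_gt0 : (0 < T)%N) (lo_gt0 : 0 < lo).
Variables (b : nat) (u : Omega) (A : R).
Hypothesis hAout : forall a, \sum_v green P T a v ^+ 2 <= A.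
Hypothesis hAin : forall a, \sum_v green P T v a ^+ 2 <= A.

Let n := (b + T.*2)%N.
Let I := ('I_b.+1 * 'I_b.+1)%type.
Implicit Types p q : I.

Definition admissible : pred I := fun p => (p.1 <= p.2)%N.
Definition meet_at (s : seq Omega) (p : I) : R := meet s p.1 (p.2 + T.*2).
Definition meet_prob (p : I) : R := pexp P n u (fun s => meet_at s p).
Definition meet_prob2 (p q : I) : R :=
  pexp P n u (fun s => meet_at s p * meet_at s q).
Definition window (i k : nat) : R := (i <= k < i + T)%N%:R.
Definition nearby (i k : nat) : bool := (i < k + T)%N && (k < i + T)%N.

Lemma window_ge0 i k : 0 <= window i k. Proof. exact: ler0n. Qed.

Lemma meet_prob2C p q : meet_prob2 p q = meet_prob2 q p.
Proof. by apply: (eq_pexp hP) => s _; rewrite mulrC. Qed.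

Lemma meet_prob2_ge0 p q : 0 <= meet_prob2 p q.
Proof.
rewrite -(pexp_const hP n u 0); apply: (pexp_le hP) => s _.
by rewrite mulr_ge0 ?meet_ge0.
Qed.

(** A window of [T] consecutive times contributes at most the [T + 1] terms that
    define the Green function. *)
Lemma sum_window N i (f : nat -> R) : (forall t, 0 <= f t) ->
  \sum_(k < N) window i k * f (k - i)%N <= \sum_(0 <= t < T.+1) f t.
Proof.
move=> f0; rewrite big_mkord.
apply: (@le_trans _ _
    (\sum_(k < N) \sum_(t < T.+1) (i + t == k)%N%:R * f t)).
  apply: ler_sum => k _; rewrite /window.
  case: (boolP (i <= k < i + T)%N) => [ik|_]; last first.
    by rewrite mul0r sumr_ge0// => t _; rewrite mulr_ge0 ?ler0n.
  have kT : (k - i < T.+1)%N by lia.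
  rewrite (bigD1 (Ordinal kT))//= subnKC ?eqxx ?lerDl; last by lia.
  by rewrite sumr_ge0// => t _; rewrite mulr_ge0 ?ler0n.
rewrite exchange_big; apply: ler_sum => t _ /=; rewrite -mulr_suml.
rewrite -[leRHS]mul1r ler_wpM2r//.
have [iN|iN] := ltnP (i + t) N.
  rewrite (bigD1 (Ordinal iN))//= eqxx big1 ?addr0// => k.
  by rewrite -val_eqE eq_sym /= => /negbTE ->.
rewrite big1 ?ler01// => k _; case: eqP => // ek.
by move: (ltn_ord k); rewrite -ek ltnNge iN.
Qed.

(** The two short stretches of a close pair range over windows independently, so
    their sum factors, for each pair of visited states, into two Green-type
    sums. *)
Lemma sum_windows (g : nat -> Omega -> Omega -> R) p :
  (forall t a c, 0 <= g t a c) ->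
  (forall a, \sum_c green P T a c * \sum_(0 <= t < T.+1) g t a c <= A) ->
  \sum_(q : I) window p.1 q.1 * window p.2 q.2 *
    (hi * \sum_a nstep P p.1 u a *
          \sum_c nstep P (q.1 - p.1) a c * g (q.2 - p.2)%N a c) <= hi * A.
Proof.
move=> g0 gA.
have -> : \sum_(q : I) window p.1 q.1 * window p.2 q.2 *
    (hi * \sum_a nstep P p.1 u a *
          \sum_c nstep P (q.1 - p.1) a c * g (q.2 - p.2)%N a c) =
  hi * \sum_a nstep P p.1 u a * \sum_c
    (\sum_(k < b.+1) window p.1 k * nstep P (k - p.1) a c) *
    (\sum_(l < b.+1) window p.2 l * g (l - p.2)%N a c).
  rewrite mulr_sumr; under [RHS]eq_bigr => a _.
    under eq_bigr do rewrite big_distrlr pair_bigA /=.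
    rewrite exchange_big /= mulr_sumr mulr_sumr.
    over.
  rewrite [RHS]exchange_big /=; apply: eq_bigr => q _.
  rewrite !mulr_sumr; apply: eq_bigr => a _.
  by rewrite !mulr_sumr; apply: eq_bigr => c _; ring.
rewrite ler_wpM2l ?hi_ge0//.
rewrite -[leRHS]mul1r -(nstep_sum1 hP x0 p.1 u) mulr_suml.
apply: ler_sum => a _; rewrite ler_wpM2l ?nstep_ge0//.
apply: le_trans (gA a); apply: ler_sum => c _.
apply: ler_pM.
- by apply: sumr_ge0 => t _; rewrite mulr_ge0 ?window_ge0 ?nstep_ge0.
- by apply: sumr_ge0 => t _; rewrite mulr_ge0 ?window_ge0.
- apply: (sum_window _ _ (f := fun t => nstep P t a c)) => t.
  exact: nstep_ge0.
- exact: (sum_window _ _ (f := fun t => g t a c)).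
Qed.

(** The close interlaced pairs give [sum_v G_T(a, v)^2 <= A]. *)
Lemma sum_interlaced :
  \sum_(p : I | admissible p) \sum_(q : I | admissible q)
    window p.1 q.1 * window p.2 q.2 * meet_prob2 p q <=
  #|admissible|%:R * (hi * A).
Proof.
rewrite mulr_natl -sumr_const; apply: ler_sum => -[i j].
rewrite /admissible /= => ij.
apply: le_trans (sum_windows (i, j) (g := nstep P) _ _); first last.
- by move=> a; apply: le_trans (hAout a); apply: ler_sum => c _; rewrite expr2.
- by move=> *; exact: nstep_ge0.
rewrite big_mkcond; apply: ler_sum => -[k l] _ /=.
rewrite /window; case: (boolP (i <= k < _)%N) => [h1|_]; last first.
  by rewrite !mul0r; case: ifP.
case: (boolP (j <= l < _)%N) => [h2|_]; last first.
  by rewrite mulr0 !mul0r; case: ifP.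
rewrite mulr1 !mul1r.
have := ltn_ord j; have := ltn_ord l => ? ?.
have -> : (l - j = l + T.*2 - (j + T.*2))%N by lia.
have le2 : meet_prob2 (i, j) (k, l) <= hi * \sum_a nstep P i u a * \sum_c
   nstep P (k - i) a c * nstep P (l + T.*2 - (j + T.*2)) a c.
  by apply: meet2_interlaced; rewrite ?/n /=; lia.
by case: ifP => // _; apply: le_trans le2; exact: meet_prob2_ge0.
Qed.

(** The close nested pairs give [sum_v G_T(a, v) G_T(v, a)], which the
    inequality of the two means bounds by the average of the two sums of
    squares. Here the pair to fix is formed by the first start and the first end,
    which belong to different pairs; the involution [sw] brings them together. *)
Lemma sum_nested :
  \sum_(p : I | admissible p) \sum_(q : I | admissible q)
    window p.1 q.1 * window q.2 p.2 * meet_prob2 p q <=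
  #|admissible|%:R * (hi * A).
Proof.
rewrite mulr_natl -sumr_const.
pose sw (pq : I * I) : I * I := ((pq.1.1, pq.2.2), (pq.2.1, pq.1.2)).
have swK : involutive sw by move=> [[i j] [k l]].
rewrite pair_big /= (reindex_inj (inv_inj swK)) /=.
apply: (@le_trans _ _ (\sum_(p : I | admissible p) \sum_(q : I)
  window p.1 q.1 * window p.2 q.2 * (hi * \sum_a nstep P p.1 u a *
   \sum_c nstep P (q.1 - p.1) a c * nstep P (q.2 - p.2)%N c a))); last first.
  apply: ler_sum => p hp.
  apply: (sum_windows p (g := fun t a c => nstep P t c a)).
    by move=> *; exact: nstep_ge0.
  move=> a; apply: (@le_trans _ _ (\sum_c
     (green P T a c ^+ 2 + green P T c a ^+ 2) / 2)).
    apply: ler_sum => c _; rewrite -/(green P T c a).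
    have := sqr_ge0 (green P T a c - green P T c a); nra.
  by rewrite -mulr_suml big_split /=; have := hAout a; have := hAin a; lra.
rewrite pair_big_dep /= big_mkcond [leRHS]big_mkcond.
apply: ler_sum => -[[i l] [k j]] _; rewrite /sw /admissible /= andbT.
rewrite /window; case: (boolP (i <= k < _)%N) => [h1|_]; last first.
  by rewrite !mul0r; do 2 case: ifP.
case: (boolP (l <= j < _)%N) => [h2|_]; last first.
  by rewrite mulr0 !mul0r; do 2 case: ifP.
rewrite mulr1 !mul1r.
have := ltn_ord j; have := ltn_ord l => ? ?.
have -> : (j - l = j + T.*2 - (l + T.*2))%N by lia.
case: ifP => [/andP[ij kl]|_].
  have -> : (i <= l)%N by lia.
  by apply: meet2_nested; rewrite ?/n /=; lia.
case: ifP => // _; rewrite mulr_ge0 ?hi_ge0// sumr_ge0// => a _.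
rewrite mulr_ge0 ?nstep_ge0// sumr_ge0// => c _.
by rewrite mulr_ge0 ?nstep_ge0.
Qed.

(** The factor 4 counts which of the two pairs starts first and which one ends
    first; exchanging the pairs reduces the four cases to two. *)
Lemma sum_nearby :
  \sum_(p : I | admissible p) \sum_(q : I | admissible q)
    (nearby p.1 q.1 && nearby p.2 q.2)%:R * meet_prob2 p q <=
  4 * #|admissible|%:R * (hi * A).
Proof.
pose sumD (f : I -> I -> R) :=
  \sum_(p : I | admissible p) \sum_(q : I | admissible q) f p q.
have swapD f : sumD f = sumD (fun p q => f q p) by rewrite /sumD exchange_big.
pose f1 p q := window p.1 q.1 * window p.2 q.2 * meet_prob2 p q.
pose f2 p q := window p.1 q.1 * window q.2 p.2 * meet_prob2 p q.
apply: (@le_trans _ _ (sumD f1 + sumD f1 + (sumD f2 + sumD f2))); last first.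
  have h1 : sumD f1 <= #|admissible|%:R * (hi * A) := sum_interlaced.
  have h2 : sumD f2 <= #|admissible|%:R * (hi * A) := sum_nested.
  lra.
rewrite {2}(swapD f1) {2}(swapD f2) -!big_split; apply: ler_sum => p _ /=.
rewrite -!big_split; apply: ler_sum => q _ /=.
rewrite /f1 /f2 (meet_prob2C q p) -!mulrDl ler_wpM2r ?meet_prob2_ge0//.
rewrite /nearby /window -!natrM -!natrD ler_nat.
by case: p => i j; case: q => k l /=; lia.
Qed.

Lemma meet_prob_lo p : admissible p -> lo <= meet_prob p.
Proof.
case: p => i j; rewrite /admissible /= => ij; apply: pexp_meet_lo.
by have := ltn_ord j; rewrite /n /=; lia.
Qed.

Let kappa := hi / lo.

Lemma kappa_ge1 : 1 <= kappa.
Proof. by rewrite /kappa ler_pdivlMr// mul1r (le_trans (hlo x0 x0)). Qed.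

(** The event that ends later has probability at most [hi] given the other one,
    and at least [lo] without conditioning. *)
Lemma corr_late p q : admissible p -> admissible q -> (q.2 + T <= p.2)%N ->
  meet_prob2 p q / (meet_prob p * meet_prob q) <= kappa.
Proof.
move=> hp hq; have := hp; have := hq; have := meet_prob_lo hp.
have := meet_prob_lo hq.
case: p q hp hq => [i j] [k l] _ _ lq lp; rewrite /admissible /= => kl ij lj.
have p0 : 0 < meet_prob (i, j) := lt_le_trans lo_gt0 lp.
have q0 : 0 < meet_prob (k, l) := lt_le_trans lo_gt0 lq.
rewrite ler_pdivrMr ?mulr_gt0// meet_prob2C.
have jb := ltn_ord j.
have := @pexp_meet2_late n u k (l + T.*2) i (j + T.*2).
move=> /(_ _ _)/le_trans-> //; rewrite ?/n; try lia.
rewrite -/(meet_prob (k, l)) /kappa mulrC.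
have -> : hi / lo * (meet_prob (i, j) * meet_prob (k, l)) =
  hi * meet_prob (k, l) * (meet_prob (i, j) / lo) by ring.
rewrite ler_peMr ?mulr_ge0 ?hi_ge0 ?(ltW q0)//.
by rewrite ler_pdivlMr// mul1r.
Qed.

Lemma corr_early p q : admissible p -> admissible q ->
  (p.1 + T <= q.1)%N -> nearby p.2 q.2 ->
  meet_prob2 p q / (meet_prob p * meet_prob q) <= kappa ^+ 2.
Proof.
move=> hp hq; have := hp; have := hq; have := meet_prob_lo hp.
have := meet_prob_lo hq.
case: p q hp hq => [i j] [k l] _ _ lq lp.
rewrite /admissible /nearby /= => kl ij ik jl.
have p0 : 0 < meet_prob (i, j) := lt_le_trans lo_gt0 lp.
have q0 : 0 < meet_prob (k, l) := lt_le_trans lo_gt0 lq.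
rewrite /kappa expr_div_n ler_pdivrMr ?mulr_gt0// -mulrA.
have jb := ltn_ord j; have lb := ltn_ord l.
have le1 : meet_prob2 (i, j) (k, l) <= hi ^+ 2.
  by apply: meet2_early; rewrite ?/n /=; lia.
apply: (le_trans le1); rewrite ler_peMr ?sqr_ge0//.
by rewrite mulrC ler_pdivlMr ?exprn_gt0// mul1r expr2 ler_pM// ltW.
Qed.

Definition reflect_pair (p : I) : I := (rev_ord p.2, rev_ord p.1).

(** Reversing time on the index set exchanges starts and ends, so as many pairs
    are far at the end as at the start. *)
Lemma sum_far_reflect :
  \sum_(p : I | admissible p) \sum_(q : I | admissible q)
    (~~ nearby p.2 q.2)%:R =
  \sum_(p : I | admissible p) \sum_(q : I | admissible q)
    (~~ nearby p.1 q.1)%:R :> R.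
Proof.
have reflect_pairK : involutive reflect_pair.
  by move=> [i j]; rewrite /reflect_pair /= !rev_ordK.
have reflect_pair_adm p : admissible (reflect_pair p) = admissible p.
  case: p => i j; rewrite /admissible /=; have := ltn_ord i.
  by have := ltn_ord j; lia.
rewrite (reindex_inj (inv_inj reflect_pairK)) /=; apply: eq_big => [p|[i j] _].
  exact: reflect_pair_adm.
rewrite (reindex_inj (inv_inj reflect_pairK)) /=; apply: eq_big => [p|[k l] _].
  exact: reflect_pair_adm.
rewrite /nearby /=; congr ((~~ _)%:R).
have := ltn_ord i; have := ltn_ord k; move: (nat_of_ord i) (nat_of_ord k).
by move=> i' k' hk hi'; rewrite andbC; congr andb; apply/idP/idP; lia.
Qed.

(** The bound [kappa^2] is needed for at most half of all [(p, q)], and [kappa]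
    covers the rest apart from the close pairs, whence the mean of the two. In
    place of a count, a multiple of the difference between the indicators of
    being far at the start and far at the end enters the bound of each term; by
    reflection it sums to zero. *)
Lemma corr_sum :
  \sum_(p : I | admissible p) \sum_(q : I | admissible q)
    meet_prob2 p q / (meet_prob p * meet_prob q) <=
  #|admissible|%:R ^+ 2 * ((kappa + kappa ^+ 2) / 2) +
  4 * #|admissible|%:R * (hi * A) / lo ^+ 2.
Proof.
have k1 := kappa_ge1.
pose far (i k : nat) : R := (~~ nearby i k)%:R.
pose close p q : R := (nearby p.1 q.1 && nearby p.2 q.2)%:R.
apply: (@le_trans _ _ (\sum_(p : I | admissible p) \sum_(q : I | admissible q)
   ((kappa + kappa ^+ 2) / 2 +
    (kappa ^+ 2 - kappa) / 2 * (far p.1 q.1 - far p.2 q.2) +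
    (lo ^+ 2)^-1 * (close p q * meet_prob2 p q)))); last first.
  pose sumD (f : I -> I -> R) :=
    \sum_(p : I | admissible p) \sum_(q : I | admissible q) f p q.
  have sumDD f g : sumD (fun p q => f p q + g p q) = sumD f + sumD g.
    by rewrite /sumD -big_split; apply: eq_bigr => p _; rewrite -big_split.
  have sumDZ a f : sumD (fun p q => a * f p q) = a * sumD f.
    by rewrite /sumD mulr_sumr; apply: eq_bigr => p _; rewrite mulr_sumr.
  rewrite -[leLHS]/(sumD _) sumDD sumDD !sumDZ.
  rewrite (sumDD (fun p q => far p.1 q.1) (fun p q => - far p.2 q.2)).
  have -> : sumD (fun p q => - far p.2 q.2) = - sumD (fun p q => far p.2 q.2).
    rewrite -mulN1r -sumDZ; apply: eq_bigr => p _.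
    by apply: eq_bigr => q _; rewrite mulN1r.
  have -> : sumD (fun p q => far p.2 q.2) = sumD (fun p q => far p.1 q.1).
    exact: sum_far_reflect.
  have sum_cst (x : R) : \sum_(p : I | admissible p) x = #|admissible|%:R * x.
    by rewrite (sumr_const admissible) mulr_natl.
  rewrite subrr mulr0 addr0 {1}/sumD !sum_cst [leLHS]addrC [leRHS]addrC.
  rewrite lerD //; last first.
    by rewrite le_eqVlt (_ : _ == _)//; apply/eqP; ring.
  rewrite mulrC.
  by rewrite ler_wpM2r ?invr_ge0 ?sqr_ge0// sum_nearby.
apply: ler_sum => p hp; apply: ler_sum => q hq.
have lp := meet_prob_lo hp; have lq := meet_prob_lo hq.
have p0 := lt_le_trans lo_gt0 lp; have q0 := lt_le_trans lo_gt0 lq.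
have corrC : meet_prob2 p q / (meet_prob p * meet_prob q) =
             meet_prob2 q p / (meet_prob q * meet_prob p).
  by rewrite meet_prob2C [meet_prob q * _]mulrC.
have k2 : 0 <= kappa ^+ 2 - kappa by rewrite expr2; nra.
have close0 : 0 <= (lo ^+ 2)^-1 * (close p q * meet_prob2 p q).
  by rewrite !mulr_ge0 ?invr_ge0 ?sqr_ge0 ?ler0n ?meet_prob2_ge0.
rewrite /far; case: (boolP (nearby p.2 q.2)) => [n2|f2].
  case: (boolP (nearby p.1 q.1)) => [n1|f1].
    rewrite subrr mulr0 addr0 /close n1 n2 mul1r.
    apply: (@le_trans _ _ ((lo ^+ 2)^-1 * meet_prob2 p q)); last by lra.
    rewrite mulrC ler_wpM2r ?meet_prob2_ge0// lef_pV2 ?posrE ?mulr_gt0//.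
    by rewrite expr2 ler_pM// ltW.
  have le1 : meet_prob2 p q / (meet_prob p * meet_prob q) <= kappa ^+ 2.
    move: f1; rewrite /nearby negb_and -!leqNgt => /orP[qp|pq].
      by rewrite corrC; apply: corr_early => //; rewrite /nearby andbC.
    exact: corr_early.
  by apply: (le_trans le1); rewrite subr0 /=; lra.
have le1 : meet_prob2 p q / (meet_prob p * meet_prob q) <= kappa.
  move: f2; rewrite /nearby negb_and -!leqNgt => /orP[qp|pq].
    exact: corr_late.
  by rewrite corrC; exact: corr_late.
apply: (le_trans le1); rewrite /=.
by case: (nearby p.1 q.1) => /=; lra.
Qed.

(** Every pair of indices is admissible itself or after exchanging its
    entries. *)
Lemma card_admissible : b.+1%:R ^+ 2 / 2 <= #|admissible|%:R :> R.
Proof.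
rewrite ler_pdivrMr// -natrX -natrM ler_nat muln2 -addnn.
pose sw (p : I) : I := (p.2, p.1).
have swK : involutive sw by case.
have cardE : #|admissible| = (\sum_(p : I) admissible p)%N.
  rewrite -sum1_card big_mkcond; apply: eq_bigr => p _.
  by rewrite unfold_in /admissible; case: (_ <= _)%N.
apply: (leq_trans _ (eq_leq (esym (f_equal2 addn cardE cardE)))).
rewrite [X in (_ <= X + _)%N](reindex_inj (inv_inj swK)) -big_split /=.
have -> : (b.+1 ^ 2 = \sum_(p : I) 1)%N.
  by rewrite sum1_card card_prod !card_ord.
apply: leq_sum => -[i j] _; rewrite /admissible /=; lia.
Qed.

(** The coefficient 8 is the 4 of [sum_nearby] over the 1/2 of
    [card_admissible]. *)
Lemma no_collision_le :
  pexp P n u (fun s => (uniq s)%:R) <=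
  1 - ((kappa + kappa ^+ 2) / 2 +
       8 * hi * A / (lo ^+ 2 * b.+1%:R ^+ 2))^-1.
Proof.
pose S s := \sum_(p : I | admissible p) (meet_prob p)^-1 * meet_at s p.
pose Q : R := #|admissible|%:R.
pose z := (kappa + kappa ^+ 2) / 2 + 8 * hi * A / (lo ^+ 2 * b.+1%:R ^+ 2).
have k1 := kappa_ge1.
have A0 : 0 <= A.
  by apply: le_trans (hAout x0); apply: sumr_ge0 => v _; exact: sqr_ge0.
have hi0 := hi_ge0.
have hQ : b.+1%:R ^+ 2 / 2 <= Q := card_admissible.
have b0 : 0 < b.+1%:R ^+ 2 :> R by rewrite exprn_gt0 ?ltr0n.
have Q0 : 0 < Q by apply: lt_le_trans hQ; rewrite divr_gt0.
have z0 : 0 < z.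
  apply: ltr_wpDr.
    by apply: divr_ge0; apply: mulr_ge0; rewrite ?sqr_ge0// mulr_ge0.
  by rewrite divr_gt0// addr_gt0 ?exprn_gt0// (lt_le_trans ltr01).
have p0 p : admissible p -> 0 < meet_prob p.
  by move=> hp; exact: lt_le_trans lo_gt0 (meet_prob_lo hp).
have ES : pexp P n u S = Q.
  rewrite /S pexp_sum /Q -sumr_const; apply: eq_bigr => p hp.
  by rewrite pexpZ mulVf// gt_eqF// p0.
have ES2 : pexp P n u (fun s => S s ^+ 2) <= Q ^+ 2 * z.
  have -> : pexp P n u (fun s => S s ^+ 2) =
     \sum_(p : I | admissible p) \sum_(q : I | admissible q)
    meet_prob2 p q / (meet_prob p * meet_prob q).
    transitivity (pexp P n u (fun s =>
      \sum_(p : I | admissible p) \sum_(q : I | admissible q)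
        (meet_prob p * meet_prob q)^-1 * (meet_at s p * meet_at s q))).
      apply: (eq_pexp hP) => s _; rewrite /S expr2 big_distrlr /=.
      apply: eq_bigr => p _; apply: eq_bigr => q _.
      by rewrite invfM; ring.
    rewrite pexp_sum; apply: eq_bigr => p _; rewrite pexp_sum.
    by apply: eq_bigr => q _; rewrite pexpZ mulrC.
  apply: (le_trans corr_sum); rewrite -/Q /z mulrDr lerD2l.
  rewrite (_ : _ / lo ^+ 2 = Q * (4 * hi * A / lo ^+ 2)); last by ring.
  rewrite [Q ^+ 2]expr2 -[Q * Q * _]mulrA ler_wpM2l ?(ltW Q0)//.
  have -> : 8 * hi * A / (lo ^+ 2 * b.+1%:R ^+ 2) =
     (4 * hi * A / lo ^+ 2) * (b.+1%:R ^+ 2 / 2)^-1.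
    by field; rewrite !gt_eqF//.
  rewrite mulrCA ler_peMr//.
    by rewrite !mulr_ge0 ?invr_ge0 ?sqr_ge0.
  by rewrite ler_pdivlMr ?divr_gt0// mul1r.
have S0 s : size s = n.+1 -> uniq s -> S s = 0.
  move=> ss us; rewrite /S big1// => -[i j]; rewrite /admissible /= => ij.
  rewrite /meet_at /meet nth_uniq//= ?ss.
  - by rewrite (_ : (_ == _)%N = false) ?mulr0//; apply/eqP; lia.
  - by have := ltn_ord j; rewrite /n; lia.
  - by have := ltn_ord j; rewrite /n; lia.
have := second_moment hP Q0 _ S0 ES ES2.
rewrite mulr_gt0 ?exprn_gt0// => /(_ isT)/le_trans; apply.
by rewrite invfM mulrA divff ?mul1r// gt_eqF// exprn_gt0.
Qed.

End Meetings.

(** * From short walks to long ones *)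

Section Numeric.
Import numFieldNormedType.Exports.
Variable R : realType.
Implicit Types x y z k : R.

(** The [1,1] Pade approximant of the exponential: the difference of the two
    sides has derivative [1 - (1 - t) exp t >= 0]. *)
Lemma pade_expR y : 0 <= y -> (2 - y) * expR y <= 2 + y.
Proof.
move=> y0; pose f (t : R) : R := 2 + t - (2 - t) * expR t.
have df (t : R) : is_derive t 1 f (1 - (1 - t) * expR t).
  by apply: is_derive_eq; rewrite /GRing.scale /=; ring.
have [|c] := @MVT_segment R f _ 0 y y0 (fun t _ => df t).
  by apply: derivable_within_continuous => t _; exact: ex_derive.
rewrite in_itv /= => /andP[c0 _].
rewrite /f expR0 => fy.
suff : 0 <= (1 - (1 - c) * expR c) * (y - 0) by lra.
rewrite subr0 mulr_ge0// subr_ge0.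
have := expR_ge1Dx (- c); rewrite expRN => h.
by rewrite -ler_pdivlMr ?expR_gt0// div1r; lra.
Qed.

(** By [pade_expR] it suffices that [z <= (2 + y)/(2y)] for [y = x/(2k^2)]. Up to
    a positive factor, the difference of the two sides is a combination, with
    nonnegative coefficients, of a square and of [16x - 5x^2 - 8], which is
    positive on [1, 5/2]. *)
Lemma block_bound k x z : 1 <= k -> 1 <= x -> x <= 5 / 2 ->
  0 < z -> z <= (k + k ^+ 2) / 2 + k ^+ 2 / x ^+ 2 ->
  1 - z^-1 <= expR (- (x / (2 * k ^+ 2))).
Proof.
move=> k1 x1 x52 z0 zle; set y := x / (2 * k ^+ 2).
have k0 : 0 < k by lra.
have x0 : 0 < x by lra.
have k2 : 0 < k ^+ 2 by rewrite exprn_gt0.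
have y0 : 0 < y by rewrite divr_gt0 ?mulr_gt0.
have zy : z <= (2 + y) / (2 * y).
  apply: (le_trans zle).
  have -> : (2 + y) / (2 * y) = (4 * k ^+ 2 + x) / (2 * x).
    by rewrite /y; field; rewrite !gt_eqF.
  rewrite ler_pdivlMr ?mulr_gt0//.
  have -> : ((k + k ^+ 2) / 2 + k ^+ 2 / x ^+ 2) * (2 * x) =
    x * (k + k ^+ 2) + 2 * k ^+ 2 / x by field; rewrite gt_eqF.
  set w := x^-1.
  have w0 : 0 < w by rewrite invr_gt0.
  rewrite -subr_ge0.
  have quad : 0 <= 16 * x - 5 * x ^+ 2 - 8 by rewrite expr2; nra.
  have -> : 4 * k ^+ 2 + x - (x * (k + k ^+ 2) + 2 * k ^+ 2 * w) =
    x * (1 - k / 2) ^+ 2 + w * k ^+ 2 * ((16 * x - 5 * x ^+ 2 - 8) / 4).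
    rewrite /w; field; rewrite gt_eqF//.
  apply: addr_ge0; apply: mulr_ge0; rewrite ?sqr_ge0 ?(ltW x0)//.
    by rewrite mulr_ge0 ?sqr_ge0 ?(ltW w0).
  by rewrite divr_ge0.
have h : (2 - y) / (2 + y) <= expR (- y).
  rewrite expRN ler_pdivrMr; last by lra.
  by rewrite mulrC ler_pdivlMr ?expR_gt0//; apply: pade_expR; exact: ltW.
apply: le_trans h.
have -> : (2 - y) / (2 + y) = 1 - ((2 + y) / (2 * y))^-1.
  by field; rewrite !gt_eqF//; lra.
by rewrite lerD2l lerN2 lef_pV2 ?posrE// divr_gt0; lra.
Qed.

End Numeric.

Section Blocks.
Variables (R : realType) (Omega : finType) (P : Omega -> Omega -> R).
Hypotheses (hP : stochastic P) (hst : stationary P (@uniform_dist R Omega)).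
Variables (T : nat) (m M : R).
Hypotheses (m_gt0 : 0 < m) (M_gt0 : 0 < M).
Let N : R := #|Omega|%:R.
Hypothesis hlo : forall u v, m / N <= nstep P T u v.
Hypothesis hhi : forall u v, nstep P T u v <= M / N.
Implicit Types (u v : Omega) (n : nat).

Let A := Num.max (A_out P T) (A_in P T).
Let sigma := Num.sqrt (2 * N / M * A).
Let L := 2 * (sigma + T%:R).
Let k := M / m.

Definition avoid n u := pexp P n u (fun s => (uniq s)%:R).

Lemma A_out_le u : \sum_v green P T u v ^+ 2 <= A.
Proof.
by rewrite le_max (le_bigmax _ (fun u => \sum_v green P T u v ^+ 2)).
Qed.

Lemma A_in_le u : \sum_v green P T v u ^+ 2 <= A.
Proof.
by rewrite le_max (le_bigmax _ (fun u => \sum_v green P T v u ^+ 2)) orbT.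
Qed.

Lemma A_ge1 u : 1 <= A.
Proof.
apply: le_trans (A_out_le u); rewrite (bigD1 u)//=.
have G1 : 1 <= green P T u u.
  rewrite /green big_nat_recl//= eqxx lerDl sumr_ge0// => i _.
  by apply: sumr_ge0 => w _; rewrite mulr_ge0 ?hP.1 ?nstep_ge0.
have : 1 <= green P T u u ^+ 2 by rewrite expr2; nra.
move=> G2; rewrite (le_trans G2)// lerDl sumr_ge0// => v _; exact: sqr_ge0.
Qed.

Lemma N_gt0 u : 0 < N.
Proof. by rewrite ltr0n; apply/card_gt0P; exists u. Qed.

Lemma sigma_sqr u : sigma ^+ 2 = 2 * N / M * A.
Proof.
rewrite sqr_sqrtr// !mulr_ge0 ?invr_ge0 ?(ltW M_gt0) ?(ltW (N_gt0 u))//.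
by have := A_ge1 u; lra.
Qed.

Lemma sigma_gt0 u : 0 < sigma.
Proof.
have A1 := A_ge1 u; have N0 := N_gt0 u.
by rewrite sqrtr_gt0 mulr_gt0 ?divr_gt0 ?mulr_gt0//; lra.
Qed.

Lemma k_ge1 u : 1 <= k.
Proof.
rewrite /k ler_pdivlMr// mul1r.
have := le_trans (hlo u u) (hhi u u).
by rewrite ler_pdivrMr ?(N_gt0 u)// divfK// gt_eqF// (N_gt0 u).
Qed.

Lemma L_gt0 u : 0 < L.
Proof. by rewrite mulr_gt0// ltr_wpDr// (sigma_gt0 u). Qed.

(** The choice of [L] makes [b = n - 2T] at least [2 x sigma], which turns the
    last term of [no_collision_le] into at most [k^2/x^2]. *)
Lemma avoid_short n u : (0 < T)%N -> L <= n%:R -> n%:R <= 5 / 2 * L ->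
  avoid n u <= expR (- (n%:R / L / (2 * k ^+ 2))).
Proof.
move=> T0 Ln nL; set x := n%:R / L.
have L0 := L_gt0 u; have s0 := sigma_gt0 u; have N0 := N_gt0 u.
have k1 := k_ge1 u; have A1 := A_ge1 u.
have nx : n%:R = x * L by rewrite /x divfK// gt_eqF.
have x1 : 1 <= x by rewrite /x ler_pdivlMr// mul1r.
have x52 : x <= 5 / 2 by rewrite /x ler_pdivrMr.
have Tn : (T.*2 <= n)%N.
  rewrite -(ler_nat R) -muln2 natrM; apply: le_trans Ln; rewrite /L; lra.
pose b := (n - T.*2)%N.
have nb : n = (b + T.*2)%N by rewrite /b subnK.
have lo0 : 0 < m / N by rewrite divr_gt0.
have hb : 2 * x * sigma <= b.+1%:R.
  have : n%:R = b%:R + T%:R * 2 :> R by rewrite nb natrD -muln2 natrM.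
  have T0R : 0 <= T%:R :> R by [].
  by rewrite nx /L -[b.+1]addn1 natrD; nra.
have := no_collision_le hP hst hlo hhi u T0 lo0 b u A_out_le A_in_le.
rewrite -nb -/(avoid n u) => /le_trans; apply.
have kE : M / N / (m / N) = k by rewrite /k; field; rewrite !gt_eqF.
rewrite kE.
have b0 : 0 < b.+1%:R :> R by rewrite ltr0n.
have zE : 8 * (M / N) * A / ((m / N) ^+ 2 * b.+1%:R ^+ 2) =
          k ^+ 2 * ((2 * sigma) ^+ 2 / b.+1%:R ^+ 2).
  rewrite [(2 * sigma) ^+ 2]exprMn (sigma_sqr u) /k; field.
  by rewrite -!natr1 in b0 *; rewrite !gt_eqF.
rewrite zE; apply: block_bound => //.
  apply: ltr_wpDr; first by rewrite mulr_ge0 ?divr_ge0 ?sqr_ge0.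
  by rewrite divr_gt0// addr_gt0 ?exprn_gt0//; lra.
rewrite lerD2l ler_wpM2l ?sqr_ge0//.
have x0 : 0 < x by lra.
rewrite -expr_div_n -exprVn ler_sqr ?nnegrE ?invr_ge0 ?(ltW x0)//; last first.
  by rewrite divr_ge0 ?mulr_ge0 ?(ltW s0).
by rewrite ler_pdivrMr// [leRHS]mulrC ler_pdivlMr//; lra.
Qed.

(** For [T = 0] the lower bound on [P^0] leaves room for a single state. *)
Lemma avoid_trivial n u : T = 0%N -> (0 < n)%N -> avoid n u = 0.
Proof.
move=> T0 n0.
have single v w : v = w.
  apply/eqP/negP => /negP vw; have := hlo v w.
  by rewrite T0 /= (negbTE vw) leNgt divr_gt0// (N_gt0 u).
rewrite /avoid -(pexp_const hP n u 0); apply: (eq_pexp hP) => -[|v s] /=.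
  by move=> n00; rewrite -n00 in n0.
by move=> _; rewrite (single v u) inE eqxx.
Qed.

(** Pieces of the least integer length above [L] are split off. As [L >= 2]
    for [T > 0], what remains of a walk longer than [5L/2] is not shorter
    than [L]. *)
Lemma avoid_le n u : L <= n%:R ->
  avoid n u <= expR (- (n%:R / L / (2 * k ^+ 2))).
Proof.
have L0 := L_gt0 u; have s0 := sigma_gt0 u => Ln.
have [T0|T0] := posnP T.
  rewrite avoid_trivial ?expR_ge0//.
  by rewrite -(ltr_nat R) (lt_le_trans L0).
have L2 : 2 <= L.
  have T1 : 1 <= T%:R :> R by rewrite ler1n.
  by rewrite /L; lra.
elim/ltn_ind: n u Ln => n IHn u Ln.
have [nL|nL] := leP (n%:R : R) (5 / 2 * L); first exact: avoid_short.
have [l [Ll lL]] : exists l : nat, L < l%:R /\ l%:R <= L + 1.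
  exists (Num.truncn L).+1; rewrite truncnS_gt -natr1 lerD2r; split=> //.
  by rewrite truncn_le ltW.
have ln : (l <= n)%N by rewrite -(ler_nat R); lra.
have nlR : (n - l)%:R = n%:R - l%:R :> R by rewrite natrB.
have := @pexp_uniqD _ _ _ hP u (n - l) l u
  (expR (- (l%:R / L / (2 * k ^+ 2)))).
rewrite subnK// -/(avoid n u) -/(avoid (n - l) u) => /(_ _)/le_trans-> //.
  by move=> v; apply: avoid_short => //; lra.
apply: (@le_trans _ _ (expR (- ((n - l)%:R / L / (2 * k ^+ 2))) *
    expR (- (l%:R / L / (2 * k ^+ 2))))).
  rewrite ler_wpM2r ?expR_ge0//; apply: IHn.
    rewrite ltn_subrL -!(ltr_nat R); apply/andP; split; lra.
  by rewrite nlR; lra.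
rewrite -expRD nlR le_eqVlt (_ : _ == _)//; apply/eqP; congr expR; ring.
Qed.

End Blocks.

(** * From paths to the probability space *)

Definition trace (W : Type) (Omega : finType) (X : nat -> W -> Omega)
  (n k : nat) (w : W) : seq Omega := [seq X i w | i <- iota k n].

Lemma collision_byE (W : Type) (Omega : finType) (X : nat -> W -> Omega) n :
  collision_by X n = [set w | ~~ uniq (trace X n.+1 0 w)].
Proof.
apply/seteqP; split => w.
  move=> [i [j [il jl ij Xij]]]; apply/negP => us.
  have sz : size (trace X n.+1 0 w) = n.+1 by rewrite size_map size_iota.
  have tE t : (t <= n)%N -> nth (X 0%N w) (trace X n.+1 0 w) t = X t w.
    by move=> tn; rewrite (nth_map 0%N) ?size_iota// nth_iota.
  by apply: ij; apply/eqP; rewrite -(nth_uniq (X 0%N w) _ _ us) ?sz// !tE// Xij.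
move=> /negP us; apply: contrapT => nc; apply: us.
rewrite map_inj_in_uniq ?iota_uniq// => i j.
rewrite !mem_iota !add0n => /andP[_ il] /andP[_ jl] Xij.
by apply: contrapT => ij; apply: nc; exists i, j.
Qed.

Section Law.
Variables (R : realType) (d : measure_display) (W : measurableType d).
Variables (Pr : probability W R) (Omega : finType) (P : Omega -> Omega -> R).
Variable X : nat -> W -> Omega.
Hypothesis hX : markov_chain Pr P X.
Implicit Types (B : seq Omega -> bool) (n k : nat) (x : nat -> Omega).

Lemma measurable_fibers (f : W -> Omega) (C : set W) :
  (forall v, measurable (C `&` [set w | f w = v])) -> measurable C.
Proof.
move=> mC; have -> : C = \bigcup_(v in [set: Omega]) (C `&` [set w | f w = v]).
  apply/seteqP; split => [w Cw|w [v _ []//]].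
  by exists (f w).
by apply: fin_bigcup_measurable; first exact: finite_finset.
Qed.

Lemma measure_fibers (f : W -> Omega) (C : set W) :
  (forall v, measurable (C `&` [set w | f w = v])) ->
  (Pr C = \sum_(v : Omega) Pr (C `&` [set w | f w = v]))%E.
Proof.
move=> mC.
have {1}-> : C = \bigcup_(v in [set: Omega]) (C `&` [set w | f w = v]).
  apply/seteqP; split => [w Cw|w [v _ []//]].
  by exists (f w).
rewrite measure_fin_bigcup//; first last.
- by move=> v w _ _ [z [[_ /= <-] [_ /= <-]]].
- exact: finite_finset.
rewrite (_ : [set: Omega] = [set` index_enum Omega]).
  by rewrite -fsbig_seq ?index_enum_uniq.
by apply/seteqP; split => // v _ /=; rewrite mem_index_enum.
Qed.

Lemma measurable_trace n k B : measurable [set w : W | B (trace X n k w)].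
Proof.
elim: n k B => [|n IHn] k B.
  rewrite (_ : [set w | _] = if B [::] then setT else set0).
    by case: ifP => _; [exact: measurableT|exact: measurable0].
  by rewrite /trace /=; case: (B [::]); apply/seteqP; split.
apply: (measurable_fibers (f := X k)) => v.
rewrite (_ : _ `&` _ = [set w | B (v :: trace X n k.+1 w)] `&`
                       [set w | X k w = v]).
  apply: measurableI; last exact: hX.1.
  exact: (IHn k.+1 (fun s => B (v :: s))).
rewrite /trace; apply/seteqP; split => w [/= Bw Xv]; split => //=.
  by move: Bw; rewrite Xv.
by move: Bw; rewrite Xv.
Qed.

Definition cylinder k x : set W :=
  [set w | forall i, (i <= k)%N -> X i w = x i].

Lemma measurable_cylinder k x : measurable (cylinder k x).
Proof.
have -> : cylinder k x = \bigcap_(i < k.+1) [set w | X i w = x i].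
  by apply/seteqP; split => w h i /= ik; exact: h.
by apply: bigcap_measurable => [|i _]; [exists 0%N|exact: hX.1].
Qed.

(** Induction on the number of remaining steps, splitting over the next state;
    this is where the defining product rule of the chain enters. *)
Lemma law_after_cylinder n k x B :
  (Pr (cylinder k x `&` [set w | B (trace X n.+1 k w)]) =
   Pr (cylinder k x) * (pexp P n (x k) (fun s => (B s)%:R))%:E)%E.
Proof.
elim: n k x B => [|n IHn] k x B.
  rewrite /= (_ : _ `&` _ = if B [:: x k] then cylinder k x else set0).
    by case: (B _); rewrite ?mule1 // measure0 mule0.
  rewrite /trace /=; case: ifPn => Bx; apply/seteqP; split => w //=.
  - by case.
  - by move=> cw; rewrite (cw k).
  - by move=> [cw]; rewrite (cw k) // (negbTE Bx).
pose ext v i := if (i <= k)%N then x i else v.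
pose B' s := B (x k :: s).
have extE v : cylinder k x `&` [set w | X k.+1 w = v] = cylinder k.+1 (ext v).
  apply/seteqP; split => [w [cw /= Xv] i ik|w cw].
    rewrite /ext; case: leqP => ki; first exact: cw.
    by rewrite -Xv; congr (X _ w); lia.
  split => [i ik|/=]; first by rewrite cw ?leqW// /ext ik.
  by rewrite cw// /ext ltnn.
rewrite (@measure_fibers (X k.+1)) => [|v]; last first.
  apply: measurableI; last exact: hX.1.
  by apply: measurableI; [exact: measurable_cylinder|exact: measurable_trace].
rewrite -(@fineK _ (Pr (cylinder k x))) ?fin_num_measure//; last first.
  exact: measurable_cylinder.
rewrite -EFinM mulr_sumr -sumEFin; apply: eq_bigr => v _.
rewrite setIAC extE.
have -> : cylinder k.+1 (ext v) `&` [set w | B (trace X n.+2 k w)] =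
    cylinder k.+1 (ext v) `&` [set w | B' (trace X n.+1 k.+1 w)].
  by apply/seteqP; split => w [cw]; rewrite /B' /trace /= (cw k)// /ext leqnn.
rewrite IHn.
have -> : Pr (cylinder k.+1 (ext v)) = (Pr (cylinder k x) * (P (x k) v)%:E)%E.
  rewrite [LHS](hX.2 k (ext v)) /ext leqnn ltnn.
  congr (Pr _ * _)%E; apply/seteqP; split => w cw i ik.
    by rewrite cw// ik.
  by rewrite ik; exact: cw.
rewrite -(@fineK _ (Pr (cylinder k x))) ?fin_num_measure//; last first.
  exact: measurable_cylinder.
by rewrite -!EFinM mulrA /ext ltnn.
Qed.

Lemma law_trace n B : (Pr [set w : W | B (trace X n.+1 0 w)] =
  \sum_(u : Omega) Pr [set w | X 0%N w = u] *
     (pexp P n u (fun s => (B s)%:R))%:E)%E.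
Proof.
have cyl0 u : cylinder 0 (fun=> u) = [set w | X 0%N w = u].
  apply/seteqP; split => [w cw|w cw [|//] _]; [exact: cw|exact: cw].
rewrite (@measure_fibers (X 0%N)) => [|v]; last first.
  by apply: measurableI; [exact: measurable_trace|exact: hX.1].
apply: eq_bigr => u _; rewrite setIC -cyl0; exact: law_after_cylinder.
Qed.

Lemma law_trace_le n B (q : R) :
  (forall u, pexp P n u (fun s => (B s)%:R) <= q) ->
  (Pr [set w : W | B (trace X n.+1 0 w)] <= q%:E)%E.
Proof.
move=> hq; rewrite law_trace.
have <- : (\sum_(u : Omega) Pr [set w | X 0%N w = u] * q%:E = q%:E)%E.
  rewrite -ge0_sume_distrl//.
  rewrite -[RHS]mul1e; congr (_ * _)%E.
  rewrite -(probability_setT Pr) (@measure_fibers (X 0%N) setT) => [|v].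
    by apply: eq_bigr => u _; rewrite setTI.
  by rewrite setTI; exact: hX.1.
by apply: lee_sum => u _; apply: lee_wpmul2l; rewrite ?lee_fin.
Qed.

End Law.

(* hround (at least 2(sqrt(...) + T) steps) only matters when
   c < m^2 / (2 M^2); it cannot be dropped altogether: on the complete graph
   on 3 vertices without loops, with T = 2, m = 3/4, M = 3/2 and c = 1/100,
   the bound in hn is less than 1, but X 0 <> X 1 almost surely. *)
Theorem theorem3p2 (R : realType) (Omega : finType) (N : nat)
    (hN : #|Omega| = N)
    (P : Omega -> Omega -> R)
    (hP : stochastic P) (hergodic : ergodic P)
    (hunif : stationary P (@uniform_dist R Omega))
    (T : nat) (m M : R)
    (hm0 : 0 < m) (hm1 : m <= 1) (hM1 : 1 <= M)
    (hT : forall u v : Omega,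
       m / N%:R <= nstep P T u v /\ nstep P T u v <= M / N%:R)
    (d : measure_display) (W : measurableType d) (Pr : probability W R)
    (X : nat -> W -> Omega) (hX : markov_chain Pr P X)
    (c : R) (hc : 0 <= c)
    (n : nat)
    (hn : 4 * c * (M / m) ^+ 2 *
          (Num.sqrt (2 * N%:R / M * Num.max (A_out P T) (A_in P T)) + T%:R)
          <= n%:R)
    (hround :
       2 * (Num.sqrt (2 * N%:R / M * Num.max (A_out P T) (A_in P T)) + T%:R)
       <= n%:R) :
  ((1 - expR (- c))%:E <= Pr (collision_by X n))%E.
Proof.
pose L : R :=
  2 * (Num.sqrt (2 * N%:R / M * Num.max (A_out P T) (A_in P T)) + T%:R).
have M0 : 0 < M by lra.
subst N.
have avoid_c u : pexp P n u (fun s => (uniq s)%:R) <= expR (- c).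
  have hlo v w := (hT v w).1; have hhi v w := (hT v w).2.
  have L0 : 0 < L := L_gt0 hP T M0 u.
  apply: (le_trans (avoid_le hP hunif hm0 M0 hlo hhi u hround)).
  rewrite ler_expR lerN2 -/L.
  have k0 : 0 < M / m by rewrite divr_gt0.
  have k20 : 0 < 2 * (M / m) ^+ 2 by rewrite mulr_gt0 ?exprn_gt0.
  rewrite ler_pdivlMr// ler_pdivlMr//.
  by apply: le_trans hn; rewrite /L; lra.
rewrite collision_byE.
have -> : [set w | ~~ uniq (trace X n.+1 0 w)] =
          ~` [set w | uniq (trace X n.+1 0 w)].
  by apply/seteqP; split => w /= /negP.
rewrite probability_setC; last first.
  exact: (measurable_trace hX _ _ (fun s => uniq s)).
have := law_trace_le hX (B := fun s => uniq s) avoid_c.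
rewrite EFinB => h; exact: leeB.
Qed.
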